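(* Let $(X,T)$ be a Polish dynamical system. If $\varphi\colon X\to\mathbb{R}$ is bounded and continuous, then the irregular set $I_\varphi(X,T)$ is a $\boldsymbol{\Sigma}^0_3$ set and $B_\varphi(X,T)=X\setminus I_\varphi(X,T)$ is a $\boldsymbol{\Pi}^0_3$ set.
   Context: A Polish dynamical system $(X,T)$ is a Polish space $X$ with a continuous map $T\colon X\to X$. $A_k\varphi(x)=\frac1k\sum_{j=0}^{k-1}\varphi(T^j(x))$ for $k\ge1$. $I_\varphi(X,T)$ is the set of $x\in X$ for which $(A_k\varphi(x))_{k\ge1}$ does not converge, and $B_\varphi(X,T)$ is the set of $x$ for which it converges. $\boldsymbol{\Sigma}^0_3$ sets are the countable unions of $G_\delta$ sets; $\boldsymbol{\Pi}^0_3$ sets are the countable intersections of $F_\sigma$ sets. *)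

(* Defs.v *)
From HB Require Import structures.
From mathcomp Require Import all_boot all_order all_algebra.
From mathcomp Require Import all_classical all_reals all_analysis borel_hierarchy.

Set Implicit Arguments.
Unset Strict Implicit.
Unset Printing Implicit Defensive.

Import Order.TTheory GRing.Theory Num.Theory.
Import numFieldNormedType.Exports.

Local Open Scope classical_set_scope.
Local Open Scope ring_scope.

Definition is_metric (R : realType) (X : Type) (d : X -> X -> R) : Prop :=
  [/\ forall x y, 0 <= d x y,
      forall x y, d x y = 0 <-> x = y,
      forall x y, d x y = d y x
    & forall x y z, d x z <= d x y + d y z].

Definition metric_induces_topology (R : realType) (X : topologicalType)
    (d : X -> X -> R) : Prop :=
  forall (x : X) (A : set X),
    nbhs x A <-> exists2 e : R, 0 < e & [set y | d x y < e] `<=` A.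

Definition metric_cauchy (R : realType) (X : Type) (d : X -> X -> R)
    (u : nat -> X) : Prop :=
  forall e : R, 0 < e ->
    exists N : nat, forall m n : nat, (N <= m)%N -> (N <= n)%N ->
      d (u m) (u n) < e.

Definition metric_complete (R : realType) (X : Type) (d : X -> X -> R) : Prop :=
  forall u : nat -> X, metric_cauchy d u ->
    exists x : X, (fun n => d (u n) x) @ \oo --> (0 : R).

Definition completely_metrizable (R : realType) (X : topologicalType) : Prop :=
  exists d : X -> X -> R,
    [/\ is_metric d, metric_induces_topology d & metric_complete d].

Definition separable_space (X : topologicalType) : Prop :=
  exists2 D : set X, countable D & dense D.

(* The complete metric is not part of the structure; only its existence is
   required. All realTypes are isomorphic, so the choice of R is immaterial. *)
Definition polish (R : realType) (X : topologicalType) : Prop :=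
  separable_space X /\ completely_metrizable R X.

Definition polish_dynamical_system (R : realType) (X : topologicalType)
    (T : X -> X) : Prop :=
  polish R X /\ continuous T.

Definition Sigma03 (X : topologicalType) (S : set X) : Prop :=
  exists2 F : (set X)^nat, (forall i, Gdelta (F i)) & S = \bigcup_i F i.

Definition Pi03 (X : topologicalType) (S : set X) : Prop :=
  exists2 F : (set X)^nat, (forall i, Fsigma (F i)) & S = \bigcap_i F i.

Definition birkhoff_average (R : realType) (X : Type) (T : X -> X)
    (phi : X -> R) (k : nat) (x : X) : R :=
  k%:R^-1 * \sum_(0 <= j < k) phi (iter j T x).

(* The averages are indexed by k >= 1, hence the shift k.+1. *)
Definition regular_set (R : realType) (X : Type) (T : X -> X)
    (phi : X -> R) : set X :=
  [set x | cvgn (fun k : nat => birkhoff_average T phi k.+1 x)].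

Definition irregular_set (R : realType) (X : Type) (T : X -> X)
    (phi : X -> R) : set X :=
  [set x | ~ cvgn (fun k : nat => birkhoff_average T phi k.+1 x)].

(* Main.v *)
Require Import Defs.
From HB Require Import structures.
From mathcomp Require Import all_boot all_order all_algebra.
From mathcomp Require Import all_classical all_reals all_analysis borel_hierarchy.
Import Order.TTheory GRing.Theory Num.Theory.
Import numFieldNormedType.Exports.
Local Open Scope classical_set_scope.
Local Open Scope ring_scope.

(** Each average is continuous, and by the Cauchy criterion the set where a
sequence of continuous real functions [f n] converges is the intersection over
[i] of the unions over [N] of the closed sets
[{x | forall n >= N, |f N x - f n x| <= 1/(i+1)}]. *)

(** Holds by completeness of [R]. Countably many tolerances and a single reference index [N] leave
    only countable set operations, and [<=] rather than [<] will give closed sets. *)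
Lemma cvgn_cauchyP (R : realType) (u : nat -> R) :
  cvgn u <-> forall i, exists N, forall n, (N <= n)%N ->
    `|u N - u n| <= i.+1%:R^-1.
Proof.
split=> [/cvg_ex[l /cvgrPdist_le ul] i|Cu].
  (* Half the tolerance, since [u N] and [u n] are compared through the limit [l]. *)
  have [|N _ uN] := ul (i.+1%:R^-1 / 2); first by rewrite divr_gt0.
  exists N => n Nn; rewrite (splitr i.+1%:R^-1).
  rewrite (le_trans (ler_distD l _ _))// lerD ?uN//.
  by rewrite distrC uN//=.
apply/cauchy_cvgP/cauchy_exP => e e0.
(* By the Archimedean property some [i.+1%:R^-1] lies below [e]. [cauchy_exP] only asks for one ball
   of radius [e] containing a tail; it is centred at [u N]. *)
have [i ie] := ltr_add_invr e0; have [N uN] := Cu i.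
exists (u N), N => // n /= Nn.
by rewrite -ball_normE/=; apply: le_lt_trans (uN _ Nn) _; rewrite -[ltLHS]add0r.
Qed.

Lemma setC_Fsigma (X : topologicalType) (S : set X) :
  Fsigma S -> Gdelta (~` S).
Proof.
by move=> [F Fc ->]; exists (fun i => ~` F i);
  [move=> i; exact/closed_openC/Fc | rewrite setC_bigcup].
Qed.

Lemma setC_Pi03 (X : topologicalType) (S : set X) : Pi03 S -> Sigma03 (~` S).
Proof.
by move=> [F FF ->]; exists (fun i => ~` F i);
  [move=> i; exact/setC_Fsigma/FF | rewrite setC_bigcap].
Qed.

Lemma Pi03_cvgn (R : realType) (X : topologicalType) (f : nat -> X -> R) :
  (forall n, continuous (f n)) -> Pi03 [set x | cvgn (f ^~ x)].
Proof.
move=> fc; pose C i N :=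
  \bigcap_(n in [set n | (N <= n)%N]) [set x | `|f N x - f n x| <= i.+1%:R^-1].
exists (fun i => \bigcup_N C i N) => [i|].
  (* Each set in the intersection is the preimage of a closed half-line under a continuous
     function. *)
  exists (C i) => // N; apply: closed_bigI => n _.
  apply: (@closed_comp _ _ (fun x => `|f N x - f n x|) [set r | r <= _]).
    by move=> x _; apply: cvg_norm; apply: cvgB; exact: fc.
  exact: closed_le.
apply/seteqP; split=> x /=.
  by move=> /cvgn_cauchyP fx i _; have [N fN] := fx i; exists N.
by move=> fx; apply/cvgn_cauchyP => i; have [N _ fN] := fx i I; exists N.
Qed.

Lemma continuous_iter (X : topologicalType) (T : X -> X) (n : nat) :
  continuous T -> continuous (iter n T).
Proof.
move=> Tc; elim: n => [|n IHn] x; first exact: cvg_id.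
exact: continuous_comp (IHn x) (Tc _).
Qed.

Lemma continuous_birkhoff_average (R : realType) (X : topologicalType)
    (T : X -> X) (phi : X -> R) (k : nat) :
  continuous T -> continuous phi -> continuous (birkhoff_average T phi k).
Proof.
(* The factor [k%:R^-1] is constant in [x]; it is split off first so that the induction concerns the
   sum alone. *)
move=> Tc phic x; apply: cvgMr; elim: k => [|k IHk].
  by under eq_fun do rewrite big_geq//; rewrite big_geq//; exact: cvg_cst.
under eq_fun do rewrite big_nat_recr//=; rewrite big_nat_recr//=.
apply: cvgD IHk _.
exact: continuous_comp (continuous_iter X T k Tc x) (phic _).
Qed.

Theorem fact14 (R : realType) (X : topologicalType) (T : X -> X)
    (hXT : polish_dynamical_system R T)
    (phi : X -> R) (phi_bounded : bounded_fun phi)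
    (phi_continuous : continuous phi) :
  [/\ Sigma03 (irregular_set T phi),
      regular_set T phi = [set: X] `\` irregular_set T phi
    & Pi03 (regular_set T phi)].
Proof.
have [_ Tc] := hXT.
have regPi : Pi03 (regular_set T phi).
  by apply: Pi03_cvgn => n; exact: continuous_birkhoff_average.
(* [irregular_set T phi] unfolds to the complement of [regular_set T phi]. *)
by split=> //; [exact: setC_Pi03 | rewrite setTD setCK].
Qed.
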